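(* Let $G$ be a countable, discrete, amenable group, let $m,k,r\in\mathbb{N}$ with $1\leq k-1<m$ and $r\geq 1$, and let $\chi$ be any finite coloring of $G^m$. Assume that for every right positive upper density set $A\subseteq G^m$ and every left IP set $X\subseteq G$ there exists a left IP set of the form $Y=X\cap D\subseteq X$, where $D\subseteq G$ is some left IP$^{\ast}$ set, such that for all $g\in Y$ there exists a right positive upper density set $B=B(g)\subseteq G^m$ such that for all $b\in B$ $$\mathfrak{R}_{b,g,(1,\ldots,k-1)}\subseteq A.$$ Then for every left IP set $X\subseteq G$ there exist $\chi$-monochromatic sets $A_0,\ldots,A_r\subseteq G^m$ of right positive upper density and left IP sets $Y_{r-1}\subseteq\cdots\subseteq Y_0\subseteq X$ such that for all $0\leq i<j\leq r$ there exists $u_{j,i}\in Y_i$ with $$\{\mathcal{R}^{(1)}_{u_{j,i}}a,\ \mathcal{R}^{(1)}_{u_{j,i}}\mathcal{R}^{(2)}_{u_{j,i}}a,\ \ldots,\ \mathcal{R}^{(1)}_{u_{j,i}}\cdots\mathcal{R}^{(k)}_{u_{j,i}}a : a\in A_j\}\subseteq A_i.$$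
   Context: $\mathcal{R}^{(j)}_g:G^m\to G^m$ denotes right multiplication by $g\in G$ on the $j$-th component. For $1\leq j_1<\dots<j_l\leq m$, $g\in G$, $x\in G^m$, the right corner set is $\mathfrak{R}_{x,g,(j_1,\ldots,j_l)}=\{x,\mathcal{R}_g^{(j_1)}x,\mathcal{R}_g^{(j_1)}\mathcal{R}_g^{(j_2)}x,\ldots,\mathcal{R}_g^{(j_1)}\cdots\mathcal{R}_g^{(j_l)}x\}$. A finite coloring of $G^m$ is a map $\chi$ from $G^m$ to a finite set of colors; a set is $\chi$-monochromatic if $\chi$ is constant on it. The number of colors is unrelated to $r$. A right Følner sequence of a countable group $H$ is a sequence $\Phi=(\Phi_n)$ of finite nonempty subsets with $\lim_n|\Phi_n\cap\Phi_nh|/|\Phi_n|=1$ for all $h\in H$ ($H$ is amenable iff one exists). A set $E\subseteq H$ is a right positive upper density set if there is a right Følner sequence $\Phi$ of $H$ with $\overline{d}_\Phi(E)=\limsup_n|E\cap\Phi_n|/|\Phi_n|>0$. Here this is used with $H=G^m$. For a sequence $(x_n)_{n\in\mathbb{N}}$ in $G$, $\mathbf{FP}_L(x_n)=\{x_{n_k}x_{n_{k-1}}\cdots x_{n_1}: k\geq 1,\ n_1<\dots<n_k\}$ (indices in decreasing order). A subset of $G$ is a left IP set if it contains $\mathbf{FP}_L(x_n)$ for some sequence $(x_n)$ in $G$; a subset of $G$ is left IP$^{\ast}$ if it meets every left IP set. *)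

(* Defs.v *)
From HB Require Import structures.
From mathcomp Require Import all_boot all_order all_algebra.
From mathcomp Require Import finmap.
From mathcomp Require Import all_classical all_reals all_analysis.

Set Implicit Arguments.
Unset Strict Implicit.
Unset Printing Implicit Defensive.

Import Order.TTheory GRing.Theory Num.Theory.
Import numFieldNormedType.Exports.

Local Open Scope classical_set_scope.
Local Open Scope ring_scope.

Section Density.
Variables (R : realType) (H : groupType).

Definition right_folner (Phi : nat -> {fset H}) : Prop :=
  (forall n, Phi n != fset0) /\
  forall h : H,
    (fun n => #|` (Phi n `&` [fset (x * h)%g | x in Phi n])%fset|%:R
              / #|` Phi n|%:R : R) @ \oo --> (1 : R).

Definition amenable : Prop := exists Phi, right_folner Phi.

(* [limn_sup] is a real limit; it is the usual limsup here because the
   quotients lie in [0, 1]. *)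
Definition upper_density (Phi : nat -> {fset H}) (E : set H) : R :=
  limn_sup (fun n => #|` [fset x in Phi n | x \in E]%fset|%:R
                     / #|` Phi n|%:R : R).

Definition right_pos_density (E : set H) : Prop :=
  exists2 Phi, right_folner Phi & 0 < upper_density Phi E.

End Density.

Section LeftIP.
Variable G : groupType.

(* The sequence of indices is nonempty and strictly decreasing, and [\prod]
   multiplies from left to right, so the largest index is leftmost. *)
Definition FP_L (x : nat -> G) : set G :=
  [set (\prod_(n <- s) x n)%g | s in [set s | s != [::] /\ sorted gtn s]].

Definition left_IP (X : set G) : Prop :=
  exists x : nat -> G, FP_L x `<=` X.

Definition left_IPstar (D : set G) : Prop :=
  forall X, left_IP X -> D `&` X !=set0.

End LeftIP.

(* Coordinates are numbered from 0: the coordinate written j on paper is the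
   element of 'I_m with value j.-1. *)
Section Corners.
Variables (G : groupType) (m : nat).
Implicit Types (x : {ffun 'I_m -> G}) (g : G) (js : seq 'I_m).

Definition rmul_at (j : 'I_m) g x : {ffun 'I_m -> G} :=
  [ffun i => if i == j then (x i * g)%g else x i].

Definition rmul_seq js g x : {ffun 'I_m -> G} :=
  foldr (fun j y => rmul_at j g y) x js.

Definition right_corner x g js : set {ffun 'I_m -> G} :=
  [set rmul_seq (take l js) g x | l in [set l : nat | (l <= size js)%N]].

(* The tuple (1, ..., l) on paper, provided l <= m. *)
Definition first_coords (l : nat) : seq 'I_m := take l (enum 'I_m).

End Corners.

Definition monochromatic (T C : Type) (chi : T -> C) (A : set T) : Prop :=
  forall a b, A a -> A b -> chi a = chi b.

(* Main.v *)
(** Rotating the coordinates, which is an automorphism of G^m, turns corners on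
    the coordinates 1, ..., k-1 into corners on 2, ..., k.  If c spans such a
    corner in A with step u, then a := c (u^-1, 1, ..., 1) has all the points
    R^(1)_u a, ..., R^(1)_u ... R^(k)_u a in A; the set of these a has positive
    upper density, because right translations preserve it, and so does its
    intersection with some color class.  Iterating this gives A_0, A_1, ... with
    u_{i+1,i} in Y_i.  If Y_i contains FP_L(x_0, x_1, ...), take u_{i+1,i} = x_0
    and choose Y_{i+1} inside FP_L(x_1, x_2, ...).  Then Y_{i+1} u_{i+1,i} is
    contained in Y_i, so u_{j,i} := u_{j,j-1} ... u_{i+1,i} lies in Y_i. *)

Require Import Defs.
From mathcomp Require Import all_boot all_order all_algebra lra.
From mathcomp Require Import finmap.
From mathcomp Require Import all_classical all_reals all_analysis.

Local Open Scope classical_set_scope.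

(** * Positive upper limits of sequences in [0, 1] *)

Section LimSup.
Set Implicit Arguments.
Unset Strict Implicit.
Import Order.TTheory GRing.Theory Num.Theory numFieldNormedType.Exports.
Local Open Scope ring_scope.
Variable R : realType.

(** The limsup is the infimum of the tail suprema. When it is positive, half of it lies strictly
    below every tail supremum and is therefore exceeded beyond every index. *)
Lemma limn_sup_gt0P (u : nat -> R) : (forall n, 0 <= u n <= 1) ->
  0 < limn_sup u <->
  exists2 e, 0 < e & forall N, exists2 n, (N <= n)%N & e <= u n.
Proof.
move=> u01.
have ub N : has_ubound (sdrop u N) by exists 1 => _ [n _ <-]; case/andP: (u01 n).
have u_sups n N : (N <= n)%N -> u n <= sups u N.
  by move=> Nn; apply: ub_le_sup => //; exists n.
have bu : bounded_fun (u : nat -> R^o).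
  exists 1; split=> // x x1 n _ /=; case/andP: (u01 n) => u0 u1.
  by rewrite ger0_norm // (le_trans u1) // ltW.
rewrite limn_supE //; split=> [inf_gt0|[e e0 eu]].
  exists (inf (range (sups u)) / 2); first by rewrite divr_gt0.
  move=> N; have lt_sup : inf (range (sups u)) / 2 < sup (sdrop u N).
    apply: (@lt_le_trans _ _ (inf (range (sups u)))).
      by rewrite ltr_pdivrMr // mulr_natr mulr2n ltrDl.
    apply: ge_inf; last by exists N.
    exists 0 => _ [n _ <-]; apply: le_trans (u_sups n n _) => //.
    by case/andP: (u01 n).
  have [_ [n /= Nn <-] /ltW lt_n] : exists2 y, sdrop u N y &
      inf (range (sups u)) / 2 < y.
    by apply: sup_gt => //; exists (u N), N => /=.
  by exists n.
apply: (lt_le_trans e0); apply: lb_le_inf; first by exists (sups u 0%N), 0%N.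
by move=> _ [N _ <-]; have [n Nn /le_trans] := eu N; apply; exact: u_sups.
Qed.

End LimSup.

(** * Permanence properties of positive upper density *)

Section Density.
Set Implicit Arguments.
Unset Strict Implicit.
Import Order.TTheory GRing.Theory Num.Theory numFieldNormedType.Exports.
Local Open Scope ring_scope.
Variable R : realType.
Implicit Types H : groupType.

Local Notation trace E F := [fset x in F | x \in (E : set _)]%fset.
Local Notation rtrans F h := [fset (x * h)%g | x in F]%fset.

(** Clearing the denominator turns the density estimates below into comparisons of cardinalities
    along a fixed Følner sequence. *)
Lemma right_pos_densityP H (E : set H) : right_pos_density R E <->
  exists Phi (e : R), [/\ right_folner R Phi, 0 < e &
    forall N, exists2 n, (N <= n)%N &
      e * #|` Phi n|%:R <= #|` trace E (Phi n)|%:R].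
Proof.
have bnd Phi : right_folner R Phi -> forall n,
    0 < #|` Phi n|%:R :> R /\
    0 <= (#|` trace E (Phi n)|%:R / #|` Phi n|%:R : R) <= 1.
  move=> [Phi0 _] n; have P0 : 0 < #|` Phi n|%:R :> R.
    by rewrite ltr0n cardfs_gt0.
  split=> //; rewrite divr_ge0 //= ler_pdivrMr // mul1r ler_nat.
  by apply/fsubset_leq_card/fsubsetP => x; rewrite !inE => /andP[].
split=> [[Phi fol]|[Phi [e [fol e0 he]]]].
  case/limn_sup_gt0P => [n|e e0 he]; first by case: (bnd Phi fol n).
  exists Phi, e; split=> // N; have [n Nn] := he N; exists n => //.
  by rewrite -ler_pdivlMr //; case: (bnd Phi fol n).
exists Phi => //; apply/limn_sup_gt0P; first by move=> n; case: (bnd Phi fol n).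
exists e => // N; have [n Nn] := he N; exists n => //.
by rewrite ler_pdivlMr //; case: (bnd Phi fol n).
Qed.

Lemma right_pos_density_setT H : amenable R H -> right_pos_density R [set: H].
Proof.
move=> [Phi fol]; apply/right_pos_densityP; exists Phi, 1; split=> // N.
exists N => //; rewrite mul1r ler_nat; apply/fsubset_leq_card/fsubsetP => x xP.
by rewrite !inE xP; apply/asboolP.
Qed.

(** Pigeonhole along one Følner sequence: if every color class eventually had small density, then
    beyond the largest threshold the classes together would be too small to make up [E]. *)
Lemma right_pos_density_color H (C : finType) (chi : H -> C) (E : set H) :
  right_pos_density R E -> exists c, right_pos_density R (E `&` chi @^-1` [set c]).
Proof.
move=> /right_pos_densityP[Phi [e [fol e0 he]]]; apply: contrapT => none.
(* The successor keeps the denominator nonzero and the total [#|C| * d] strictly below [e]. *)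
pose d := e / #|C|.+1%:R.
have d0 : 0 < d by rewrite divr_gt0.
pose P c N := forall n, (N <= n)%N ->
  #|` trace (E `&` chi @^-1` [set c])%classic (Phi n)|%:R < d * #|` Phi n|%:R.
have /boolp.choice[N hN] : forall c, exists N, P c N.
  move=> c; apply: contrapT => nN; apply: none; exists c.
  apply/right_pos_densityP; exists Phi, d; split=> // N.
  apply: contrapT => nn; apply: nN; exists N => n Nn.
  by rewrite ltNge; apply/negP => le_n; apply: nn; exists n.
have [n Nn] := he (\max_c N c); apply/negP; rewrite -ltNge.
have Phi0 : 0 < #|` Phi n|%:R :> R by rewrite ltr0n cardfs_gt0; case: fol.
have -> : #|` trace E (Phi n)| =
    (\sum_c #|` trace (E `&` chi @^-1` [set c])%classic (Phi n)|)%N.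
  rewrite -sum1_size (partition_big chi xpredT) //=; apply: eq_bigr => c _.
  rewrite -big_filter sum1_size; apply: perm_size; apply: uniq_perm.
  - exact/filter_uniq/fset_uniq.
  - exact: fset_uniq.
  move=> x; rewrite mem_filter !inE /=; apply/idP/idP.
    case/and3P=> /eqP xc -> /asboolP xE; apply/asboolP; split => //.
  by case/andP=> -> /asboolP[xE ->]; rewrite eqxx; apply/asboolP.
rewrite natr_sum; apply: (@le_lt_trans _ _ (\sum_(c : C) d * #|` Phi n|%:R)).
  apply: ler_sum => c _; apply/ltW/hN/(leq_trans _ Nn); exact: leq_bigmax.
rewrite sumr_const -mulrnAl ltr_pM2r // -mulr_natr /d mulrAC.
by rewrite ltr_pdivrMr // ltr_pM2l // ltr_nat.
Qed.

(** A point of [E] in both [Phi n] and [Phi n * h] is [y * h] with [y] in [Phi n] and in the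
    translated set. Only points of [Phi n] outside [Phi n * h] are lost. *)
Lemma right_pos_density_rtrans H (E : set H) (h : H) :
  right_pos_density R E -> right_pos_density R [set x | E (x * h)%g].
Proof.
move=> /right_pos_densityP[Phi [e [fol e0 he]]]; apply/right_pos_densityP.
have [Phi0 lim] := fol.
exists Phi, (e / 2); split=> //; first by rewrite divr_gt0.
(* Eventually the lost part is at most [e / 2] of [Phi n], so density [e / 2] remains. *)
have /cvgr_ge/(_ (1 - e / 2)) := lim h.
rewrite ltrBlDr ltrDl divr_gt0 // => /(_ isT)[M _ hM] N.
have [n Mn le_n] := he (maxn M N).
exists n; first by rewrite (leq_trans _ Mn) // leq_maxr.
have {hM} := hM n (leq_trans (leq_maxl _ _) Mn).
have P0 : 0 < #|` Phi n|%:R :> R by rewrite ltr0n cardfs_gt0.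
rewrite /= ler_pdivlMr // => hM.
have card_tr (F : {fset H}) : #|` rtrans F h| = #|` F|.
  by rewrite card_imfset //=; exact: mulIg.
have le_shift : (#|` trace E (Phi n)| <=
    #|` trace [set x | E (x * h)%g] (Phi n)| +
     (#|` Phi n `\` rtrans (Phi n) h|)%fset)%N.
  rewrite -[X in (_ <= X + _)%N](card_tr).
  apply: (leq_trans _ (leq_card_fsetU _ _)).
  apply/fsubset_leq_card/fsubsetP => x.
  rewrite !inE => /andP[xP xE]; rewrite xP andbT.
  have [/imfsetP[y /= yP xy]|_] := boolP (x \in rtrans (Phi n) h);
    last by rewrite orbT.
  rewrite orbF; apply/imfsetP; exists y => //=.
  by rewrite !inE yP; apply/asboolP; rewrite /= -xy; apply/asboolP.
move: le_shift hM le_n; rewrite -(ler_nat R) natrD.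
rewrite -(cardfsID (rtrans (Phi n) h) (Phi n)) natrD.
set a := #|` (_ `&` _)%fset|%:R; set b := #|` (_ `\` _)%fset|%:R.
by set c := #|` _|%:R; set d := #|` _|%:R; nra.
Qed.

(** The isomorphism [f'] carries [Phi] to a Følner sequence of [H] and preserves all the
    cardinalities involved. *)
Lemma right_pos_density_preim (H H' : groupType) (f : H -> H') (f' : H' -> H)
  (E : set H') : {morph f' : x y / (x * y)%g} -> cancel f f' -> cancel f' f ->
  right_pos_density R E -> right_pos_density R (f @^-1` E).
Proof.
move=> f'M fK f'K /right_pos_densityP[Phi [e [[Phi0 lim] e0 he]]].
have f'I := can_inj f'K.
have cardf' (F : {fset H'}) : #|` [fset f' x | x in F]%fset| = #|` F|.
  by rewrite card_imfset.
have trace_f' (F : {fset H'}) : trace (f @^-1` E)%classic [fset f' x | x in F]%fset =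
    [fset f' x | x in trace E F]%fset.
  apply/fsetP => x; rewrite !inE; apply/andP/imfsetP => /=.
    case=> /imfsetP[y /= yF ->] /asboolP; rewrite /= f'K => yE; exists y => //.
    by rewrite !inE yF; apply/asboolP.
  by case=> y; rewrite !inE => /andP[yF /asboolP yE] ->; rewrite in_imfset //= f'K.
apply/right_pos_densityP; exists (fun n => [fset f' x | x in Phi n]%fset), e.
split=> //; last first.
  by move=> N; have [n Nn] := he N; exists n => //; rewrite trace_f' !cardf'.
split=> [n|h].
  by rewrite -cardfs_gt0 cardf' cardfs_gt0.
rewrite [X in X @ _](_ : _ = fun n => #|` (Phi n `&` rtrans (Phi n) (f h))%fset|%:R
   / #|` Phi n|%:R); first exact: lim.
apply/funext => n; rewrite cardf' -(cardf' (_ `&` _)%fset); congr (#|` _|%:R / _).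
apply/fsetP => x; rewrite inE; apply/andP/imfsetP => /=.
  case=> /imfsetP[y /= yP ->] /imfsetP[_ /= /imfsetP[z /= zP ->] yz].
  exists y => //; rewrite inE yP; apply/imfsetP; exists z => //=.
  by rewrite -[h]fK -f'M in yz; exact: f'I.
case=> y; rewrite inE => /andP[yP /imfsetP[z /= zP yz]] ->; rewrite in_imfset //.
split=> //; apply/imfsetP; exists (f' z); first exact: in_imfset.
by rewrite yz f'M fK.
Qed.

End Density.

(** * Amenability of finite powers *)

Section ProductFolner.
Import Order.TTheory GRing.Theory Num.Theory numFieldNormedType.Exports.
Local Open Scope ring_scope.
Variables (I : finType) (G : groupType).
Implicit Types A : I -> {fset G}.

(** [G] may be infinite, so the box is enumerated through the finite type of choices of one point in
    each [A i]. *)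
Definition fbox A : {fset {ffun I -> G}} :=
  [fset x in [seq [ffun i => val (h i)] | h : {dffun forall i, A i}]]%fset.

Lemma in_fbox A x : (x \in fbox A) = [forall i, x i \in A i].
Proof.
rewrite inE /=; apply/mapP/forallP => [[h _ ->] i|xA].
  by rewrite ffunE; exact: valP.
pose h : {dffun forall i, A i} := [ffun i => [` xA i]%fset].
by exists h; rewrite ?mem_enum //; apply/ffunP => i; rewrite !ffunE.
Qed.

Lemma card_fbox A : #|` fbox A| = (\prod_i #|` A i|)%N.
Proof.
rewrite card_fseq undup_id ?size_map.
  rewrite -enumT -cardE card_dep_ffun foldrE big_map big_enum.
  apply: eq_bigr => i _.
  by rewrite cardfE.
rewrite map_inj_uniq -?enumT ?enum_uniq // => h h' eq_h; apply/ffunP => i.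
by apply: val_inj; move/ffunP/(_ i): eq_h; rewrite !ffunE.
Qed.

Lemma fbox_translate A (h : {ffun I -> G}) :
  (fbox A `&` [fset (x * h)%g | x in fbox A] =
   fbox (fun i => A i `&` [fset (x * h i)%g | x in A i]))%fset.
Proof.
apply/fsetP => x; rewrite inE !in_fbox; apply/andP/forallP => /=.
  case=> /forallP xA /imfsetP[y /=]; rewrite in_fbox => /forallP yA xy i.
  by rewrite inE xA; apply/imfsetP; exists (y i); rewrite // xy ffunE.
move=> xA; split; first by apply/forallP => i; have := xA i; rewrite inE => /andP[].
have /fin_all_exists[y hy] : forall i, exists y, y \in A i /\ x i = (y * h i)%g.
  by move=> i; have := xA i; rewrite inE => /andP[_ /imfsetP[y /= ? ?]]; exists y.
apply/imfsetP; exists (finfun y) => /=.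
  by rewrite in_fbox; apply/forallP => i; rewrite ffunE; case: (hy i).
by apply/ffunP => i; rewrite !ffunE; case: (hy i).
Qed.

(** The overlap ratio of the boxes with all sides [Phi n] is the product over [I] of the ratios of
    their sides, each of which tends to 1. *)
Lemma amenable_ffun (R : realType) : amenable R G -> amenable R {ffun I -> G}.
Proof.
move=> [Phi [Phi0 lim]]; exists (fun n => fbox (fun=> Phi n)); split=> [n|h].
  by rewrite -cardfs_gt0 card_fbox prodn_gt0 // => i; rewrite cardfs_gt0.
have /(@cvg_big R I *%R (1 : R) xpredT (@mul_continuous R) _ _ (index_enum I)) :
    forall i, true -> (fun n => #|` (Phi n `&` [fset (x * h i)%g | x in Phi n])%fset|%:R
      / #|` Phi n|%:R : R) @ \oo --> (1 : R) by move=> i _; exact: lim.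
rewrite big1_eq; apply: cvg_trans; apply: near_eq_cvg; apply: nearW => n /=.
by rewrite prodf_div fbox_translate !card_fbox !natr_prod.
Qed.

End ProductFolner.

(** * Tails of left IP sets *)

Section LeftIP.
Local Open Scope group_scope.
Variable G : groupType.

(** Take the first generator for [v] and the products of the later ones for [X]. Indices decrease
    from left to right, so [v] enters on the right. *)
Lemma left_IP_tail (Y : set G) : left_IP Y ->
  exists v X, [/\ Y v, left_IP X, X `<=` Y & forall w, X w -> Y (w * v)].
Proof.
case=> x xY; exists (x 0%N), (FP_L (fun n => x n.+1)).
have S_sorted s : sorted gtn s -> sorted gtn (map S s) by rewrite sorted_map.
have prodS s : \prod_(n <- s) x n.+1 = \prod_(n <- map S s) x n.
  by rewrite big_map.
split.
- by apply: xY; exists [:: 0%N] => //; rewrite big_seq1.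
- by exists (fun n => x n.+1).
- move=> _ [s [s0 s_sorted] <-]; apply: xY; exists (map S s) => //.
  by split; [case: s s0 {s_sorted} | exact: S_sorted].
(* The shifted indices are positive, so appending 0 keeps the sequence strictly decreasing. *)
- move=> _ [s [s0 s_sorted] <-]; apply: xY; exists (rcons (map S s) 0%N).
    split; first by case: s {s0 s_sorted}.
    case: s s0 s_sorted => // n s _ /S_sorted /=.
    by rewrite rcons_path => -> /=; rewrite last_map.
  by rewrite big_rcons prodS.
Qed.

End LeftIP.

(** * Corners and rotation of coordinates *)

Section Corners.
Variables (G : groupType) (m : nat).
Implicit Types (x : {ffun 'I_m -> G}) (u : G).
Local Open Scope group_scope.

Lemma rmul_seqE (js : seq 'I_m) u x : uniq js ->
  rmul_seq js u x = [ffun i => if i \in js then x i * u else x i].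
Proof.
elim: js => [|j js IH] /=; first by move=> _; apply/ffunP => i; rewrite ffunE.
case/andP=> jjs /IH ->; apply/ffunP => i; rewrite !ffunE in_cons.
by have [->|] := eqVneq i j; rewrite ?(negPf jjs).
Qed.

Lemma rmul_firstE l u x : rmul_seq (first_coords m l) u x =
  [ffun i : 'I_m => if (i < l)%N then x i * u else x i].
Proof.
rewrite rmul_seqE ?take_uniq ?enum_uniq //; apply/ffunP => i; rewrite !ffunE.
congr (if _ then _ else _); rewrite -(mem_map val_inj) map_take val_enum_ord.
by rewrite take_iota mem_iota add0n /= ltn_min ltn_ord andbT.
Qed.

(** The left factor acts first, which matches the decreasing order of products in [FP_L]. *)
Lemma rmul_firstM l u v x : rmul_seq (first_coords m l) (u * v) x =
  rmul_seq (first_coords m l) v (rmul_seq (first_coords m l) u x).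
Proof.
by rewrite !rmul_firstE; apply/ffunP => i; rewrite !ffunE; case: ifP; rewrite ?mulgA.
Qed.

(** [ordS] and [ord_pred] are cyclic. For [l < m], conjugating by these rotations moves a corner on
    coordinates 0, ..., l-1 to coordinates 1, ..., l. *)
Definition coord_rotl x : {ffun 'I_m -> G} := [ffun i => x (ordS i)].
Definition coord_rotr x : {ffun 'I_m -> G} := [ffun i => x (ord_pred i)].

Lemma coord_rotlK : cancel coord_rotl coord_rotr.
Proof. by move=> x; apply/ffunP => i; rewrite !ffunE ord_predK. Qed.

Lemma coord_rotrK : cancel coord_rotr coord_rotl.
Proof. by move=> x; apply/ffunP => i; rewrite !ffunE ordSK. Qed.

Lemma coord_rotlM : {morph coord_rotl : x y / x * y}.
Proof. by move=> x y; apply/ffunP => i; rewrite !ffunE. Qed.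

Lemma coord_rotrM : {morph coord_rotr : x y / x * y}.
Proof. by move=> x y; apply/ffunP => i; rewrite !ffunE. Qed.

(** The rotated corner accounts for coordinates 1, ..., l and the translation for coordinate 0. *)
Lemma coord_rotr_rmul_first l u x : (l < m)%N ->
  coord_rotr (rmul_seq (first_coords m l) u
         (coord_rotl (x * [ffun i : 'I_m => if (i : nat) == 0%N then u else 1]))) =
  rmul_seq (first_coords m l.+1) u x.
Proof.
move=> lm; rewrite !rmul_firstE; apply/ffunP => i; rewrite !ffunE ord_predK /=.
have m_gt0 : (0 < m)%N by apply: leq_ltn_trans lm.
(* The cyclic predecessor of 0 is m-1, which is not below [l], so coordinate 0 is not multiplied
   twice. *)
have [i0|i_gt0] := posnP i.
  by rewrite i0 add0n modn_small ?prednK //= leqNgt lm.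
rewrite -(prednK i_gt0) addSn /= modnDr modn_small ?mulg1 //.
by rewrite prednK //; apply: ltnW.
Qed.

End Corners.

(** * One step of focusing *)

Section Focusing.
Variables (R : realType) (G : groupType) (m k : nat) (C : finType).
Variable chi : {ffun 'I_m -> G} -> C.
Hypotheses (k_gt0 : (0 < k)%N) (k_le_m : (k - 1 < m)%N).
Hypothesis corners : forall (A : set {ffun 'I_m -> G}) (X : set G),
  right_pos_density R A -> left_IP X ->
  exists D : set G,
    [/\ left_IPstar D, left_IP (X `&` D) &
     forall g, (X `&` D) g ->
     exists2 B : set {ffun 'I_m -> G}, right_pos_density R B &
       forall b, B b -> right_corner b g (first_coords m (k - 1)) `<=` A].
Local Open Scope group_scope.

(** [Y] is produced before [u], while [A'] may depend on [u]; this leaves [u] free to be the first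
    generator of an IP set inside [Y]. *)
Lemma focusing_step (A : set {ffun 'I_m -> G}) (X : set G) :
  right_pos_density R A -> left_IP X ->
  exists Y, [/\ left_IP Y, Y `<=` X &
    forall u, Y u -> exists A' : set {ffun 'I_m -> G},
      [/\ right_pos_density R A', monochromatic chi A' &
       forall l a, (1 <= l <= k)%N -> A' a ->
         A (rmul_seq (first_coords m l) u a)]].
Proof.
move=> A_pos X_IP.
have rotA_pos := right_pos_density_preim
  (@coord_rotlM G m) (@coord_rotrK _ _) (@coord_rotlK _ _) A_pos.
have [D [_ Y_IP corner]] := corners rotA_pos X_IP.
exists (X `&` D); split=> // u Yu.
have [B B_pos BA] := corner u Yu.
have rotB_pos := right_pos_density_preim
  (@coord_rotrM G m) (@coord_rotlK _ _) (@coord_rotrK _ _) B_pos.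
have := right_pos_density_rtrans [ffun i : 'I_m => if (i : nat) == 0%N then u else 1]
  rotB_pos.
case/(right_pos_density_color chi) => c A'_pos; eexists; split; first exact: A'_pos.
  by move=> a b [_ ->] [_ ->].
(* The point with index [l.+1] over [a] comes from the corner point with index [l], the base point
   of the corner giving index 1. *)
move=> [//|l] a /= lk [/BA BA' _].
have lk1 : (l <= k - 1)%N by rewrite subn1 -ltnS prednK.
rewrite -coord_rotr_rmul_first; last exact: leq_ltn_trans k_le_m.
apply: BA'; exists l; last by rewrite /first_coords take_takel.
by rewrite /= size_takel // size_enum_ord ltnW.
Qed.

End Focusing.

(** * Iteration of the focusing step *)

Theorem theorem11 (R : realType) (G : groupType)
  (G_countable : countable [set: G]) (G_amenable : amenable R G)
  (m k r : nat) (k_gt1 : (1 <= k - 1)%N) (k_le_m : (k - 1 < m)%N)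
  (r_gt0 : (1 <= r)%N)
  (C : finType) (chi : {ffun 'I_m -> G} -> C)
  (corners : forall (A : set {ffun 'I_m -> G}) (X : set G),
     right_pos_density R A -> left_IP X ->
     exists D : set G,
       [/\ left_IPstar D, left_IP (X `&` D) &
        forall g, (X `&` D) g ->
        exists2 B : set {ffun 'I_m -> G}, right_pos_density R B &
          forall b, B b -> right_corner b g (first_coords m (k - 1)) `<=` A]) :
  forall X : set G, left_IP X ->
  exists (A : nat -> set {ffun 'I_m -> G}) (Y : nat -> set G),
    [/\ forall i, (i <= r)%N ->
          right_pos_density R (A i) /\ monochromatic chi (A i),
        forall i, (i < r)%N -> left_IP (Y i),
        forall i, (i.+1 < r)%N -> Y i.+1 `<=` Y i,
        Y 0%N `<=` X &
        forall i j, (i < j)%N -> (j <= r)%N ->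
        exists2 u : G, Y i u &
          [set rmul_seq (first_coords m l) u a
             | l in [set l : nat | (1 <= l <= k)%N] & a in A j] `<=` A i].
Proof.
move=> X X_IP.
have k_gt0 : (0 < k)%N by apply: leq_trans k_gt1 _; exact: leq_subr.
(* A state holds the set A_i and the IP set inside which Y_i is to be chosen. *)
pose state := {s : set {ffun 'I_m -> G} * set G |
  [/\ right_pos_density R s.1, monochromatic chi s.1 & left_IP s.2]}.
(* Here [Y] is Y_i and [v] is u_{i+1,i}. The second component of [s'] is a tail of an IP set in [Y],
   so multiplying it by [v] on the right stays in [Y]. *)
pose next (s s' : state) (Y : set G) (v : G) :=
  [/\ left_IP Y, Y `<=` (sval s).2, Y v,
      (sval s').2 `<=` Y /\ forall w, (sval s').2 w -> Y (w * v)%g &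
      forall l a, (1 <= l <= k)%N -> (sval s').1 a ->
        (sval s).1 (rmul_seq (first_coords m l) v a)].
have step (s : state) : {s' | exists Y v, next s s' Y v}.
  apply: cid; have [A_pos _ X'_IP] := svalP s.
  have [Y [Y_IP YX foc]] := focusing_step chi k_gt0 k_le_m corners A_pos X'_IP.
  have [v [Z [Yv Z_IP ZY Zv]]] := left_IP_tail Y_IP.
  have [A' [A'_pos A'_mono A'A]] := foc v Yv.
  by exists (exist _ (A', Z) (And3 A'_pos A'_mono Z_IP)), Y, v.
(* A_0 is a color class of positive upper density in the whole power, which has positive density by
   amenability. *)
have [c A0_pos] := right_pos_density_color chi
  (right_pos_density_setT (amenable_ffun 'I_m G_amenable)).
have A0_mono : monochromatic chi ([set: {ffun 'I_m -> G}] `&` chi @^-1` [set c]).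
  by move=> a b [_ ->] [_ ->].
pose s0 : state := exist _ (_, X) (And3 A0_pos A0_mono X_IP).
have [s [s_0 /choice[Y /choice[v sYv]]]] := dependent_choice step s0.
pose A i := (sval (s i)).1.
have sub i : Y i.+1 `<=` Y i.
  have [_ Yi _ _ _] := sYv i.+1; have [_ _ _ [Yi' _] _] := sYv i.
  exact: subset_trans Yi Yi'.
(* The gap j - i is [d.+1]; the induction peels off the lowest step, so [i] must vary. *)
have reach d i : exists2 u, Y i u & forall l a, (1 <= l <= k)%N ->
    A (i + d.+1)%N a -> A i (rmul_seq (first_coords m l) u a).
  elim: d i => [|d IH] i; first by exists (v i); rewrite ?addn1; case: (sYv i).
  have [u Yu uA] := IH i.+1; have [_ _ _ [_ Yv] vA] := sYv i.
  have [_ YX _ _ _] := sYv i.+1.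
  (* This is u_{j,i} = u_{j,i+1} u_{i+1,i}: [v i] leads from A_i's condition back to A_{i+1}, where
     [u] takes over. *)
  exists (u * v i)%g; first exact/Yv/YX.
  move=> l a lk Aa; rewrite rmul_firstM; apply: vA => //; apply: uA => //.
  by rewrite addSnnS.
exists A, Y; split.
- by move=> i _; case: (svalP (s i)).
- by move=> i _; case: (sYv i).
- by move=> i _; exact: sub.
- by case: (sYv 0%N) => _; rewrite s_0.
- move=> i j ij _; have [u Yu uA] := reach (j - i.+1)%N i; exists u => //.
  move=> _ [l lk [a Aa] <-]; apply: uA => //.
  by rewrite -addSnnS subnKC.
Qed.
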